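(* Let $G=(V,E)$ be an oriented 3-edge-connected graph with $\ell=|E|-|V|$ and let $\Gamma$ be an abelian group with $|\Gamma|=k\ge 6$ ($k$ finite). For every function $f:E\to\Gamma$, the number of flows $\phi:E\to\Gamma$ satisfying $\phi(e)\neq f(e)$ for every $e\in E$ is at least $$\frac12\left(\frac{k-6}{2}\right)^{\ell}\ \text{ if } k \text{ is odd},\qquad \frac12\left(\frac{k-4}{2}\right)^{\ell}\ \text{ if } k \text{ is even}.$$
   Context: Graphs are finite and may have loops and parallel edges. A graph is $k$-edge-connected if it has at least two vertices and remains connected after deleting any set of fewer than $k$ edges (for oriented graphs this refers to the underlying undirected graph). For an oriented graph $G=(V,E)$ and $v\in V$, $\delta^+(v)$ is the set of edges with initial vertex $v$ and $\delta^-(v)$ the set of edges with terminal vertex $v$ (a loop at $v$ belongs to both). For an additive abelian group $\Gamma$, a flow is a function $\phi:E\to\Gamma$ with $\sum_{e\in\delta^+(v)}\phi(e)=\sum_{e\in\delta^-(v)}\phi(e)$ for every $v\in V$. *)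

(* Defs.v *)
From HB Require Import structures.
From mathcomp Require Import all_boot all_order all_algebra.

Set Implicit Arguments.
Unset Strict Implicit.
Unset Printing Implicit Defensive.

Import GRing.Theory.
Local Open Scope ring_scope.

(* Loops and parallel edges are allowed. *)
Record ograph := OGraph {
  vertex : finType;
  edge : finType;
  init : edge -> vertex;
  term : edge -> vertex
}.

Definition out_edges (G : ograph) (v : vertex G) : {set edge G} :=
  [set e | init e == v].

Definition in_edges (G : ograph) (v : vertex G) : {set edge G} :=
  [set e | term e == v].

(* Adjacency, ignoring orientation, after deletion of the edges in F. *)
Definition adj_del (G : ograph) (F : {set edge G}) : rel (vertex G) :=
  [rel u v | [exists e : edge G, (e \notin F) &&
     ((init e == u) && (term e == v) || (init e == v) && (term e == u))]].

Definition edge_connected (k : nat) (G : ograph) : Prop :=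
  (2 <= #|vertex G|)%N /\
  forall F : {set edge G}, (#|F| < k)%N ->
    forall u v : vertex G, connect (adj_del F) u v.

Definition is_flow (G : ograph) (A : zmodType)
    (phi : {ffun edge G -> A}) : bool :=
  [forall v : vertex G,
     \sum_(e in out_edges v) phi e == \sum_(e in in_edges v) phi e].

Definition flows_avoiding (G : ograph) (A : finZmodType) (f : edge G -> A)
    : {set {ffun edge G -> A}} :=
  [set phi | is_flow phi && [forall e, phi e != f e]].

(* Main.v *)
Require Import Defs.
From HB Require Import structures.
From mathcomp Require Import all_boot all_order all_algebra all_fingroup all_solvable.
From mathcomp Require Import zify.

(* The proof finds a set S of edges whose complement is connected and spanning
   and such that all edges are reached from S by repeatedly closing up circuits
   with at most two edges not yet reached.  Fix a <> 0 in Gamma, with 2a = 0 if k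
   is even.  Processing the circuits backwards and adding a suitable multiple of
   each one produces many flows psi with psi(e) not in {f(e), f(e) + a, f(e) - a}
   for all e outside S: the coefficient of a circuit has at most 2q forbidden
   values, where q = 3, or q = 2 if 2a = 0.  The set B of edges of S where
   psi = f extends, through the complement of S, to an even subgraph; an Eulerian
   orientation of it is a flow chi with values 0, 1, -1, and psi + a chi avoids f
   everywhere.  At most 2^|S| flows psi give the same result.
   The set S is built by enlarging a vertex set U.  A component H of the
   complement of U is split into a connected spanning part F and a rest that
   joins the H-ends of two edges from U to H; a tree of the rest is put into S. *)

Set Implicit Arguments.
Unset Strict Implicit.
Unset Printing Implicit Defensive.

Import Order.TTheory GRing.Theory Num.Theory.
Local Open Scope ring_scope.

(** * Connectivity and cuts *)

Section Links.
Variable G : ograph.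
Implicit Types (u v w : vertex G) (e : edge G) (A B F : {set edge G}) (C D U K H : {set vertex G}).

(** Since [adj_del] takes the deleted edges, [links A] is connection by edges of [A] only. *)
Definition links A : rel (vertex G) := connect (adj_del (~: A)).
Definition inner U : {set edge G} := [set e | (init e \in U) && (term e \in U)].
Definition cut D : {set edge G} := [set e | (init e \in D) (+) (term e \in D)].
(** Meant for an edge of [cut D], where it is the end in [D]. For every edge, [side] and [far] are
    its two ends in some order. *)
Definition side D e : vertex G := if init e \in D then init e else term e.

Lemma adj_sym A : symmetric (adj_del A).
Proof.
by move=> u v; apply/existsP/existsP=> -[e /andP[eA]]; rewrite orbC => uv;
   exists e; rewrite eA.
Qed.

Lemma links_sym A : symmetric (links A).
Proof. exact/sym_connect_sym/adj_sym. Qed.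

Lemma links_refl A u : links A u u. Proof. exact: connect0. Qed.

Lemma links_trans A : transitive (links A).
Proof. exact: connect_trans. Qed.

Lemma links_edge A e : e \in A -> links A (init e) (term e).
Proof.
by move=> eA; apply/connect1/existsP; exists e; rewrite !inE eA !eqxx.
Qed.

Lemma links_subst A B :
  {in A, forall e, links B (init e) (term e)} -> subrel (links A) (links B).
Proof.
move=> AB; apply: connect_sub => u v /existsP[e].
rewrite inE negbK => /andP[/AB eB /orP[]/andP[/eqP<- /eqP<-]] //.
by rewrite -/(links B _ _) links_sym.
Qed.

Lemma links_sub A B : A \subset B -> subrel (links A) (links B).
Proof. by move=> /subsetP AB; apply: links_subst => e /AB/links_edge. Qed.

Lemma links_exit A C u v :
  links A u v -> u \in C -> v \notin C -> exists2 e, e \in A & e \in cut C.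
Proof.
move=> uv uC vC; have [/exists_inP[e]|/exists_inPn noe] := boolP [exists e in A, e \in cut C].
  by exists e.
suff /closed_connect/(_ _ _ uv) : closed (adj_del (~: A)) C by rewrite uC (negPf vC).
move=> x y /existsP[e]; rewrite inE negbK => /andP[/noe].
by rewrite inE => xy /orP[]/andP[/eqP<- /eqP<-]; case: (_ \in C) (_ \in C) xy => [] [].
Qed.

Lemma links_stay A C u v :
  u \in C -> A :&: cut C = set0 -> links A u v -> v \in C.
Proof.
move=> uC AC uv; apply: contraT => vC.
have [e eA eC] := links_exit uv uC vC.
by have := in_set0 e; rewrite -AC inE eA eC.
Qed.

Lemma cut_side D e : e \in cut D -> side D e \in D.
Proof. by rewrite inE /side; case: ifP. Qed.

Lemma inner_sub C D : C \subset D -> inner C \subset inner D.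
Proof.
by move=> /subsetP CD; apply/subsetP=> e; rewrite !inE => /andP[/CD-> /CD->].
Qed.

Lemma side_sub C D e : C \subset D -> e \in cut C -> e \in cut D -> side D e = side C e.
Proof.
move=> /subsetP CD; rewrite !inE /side; move: (CD (init e)) (CD (term e)).
case: (init e \in C) (init e \in D) (term e \in C) (term e \in D) => [] [] [] [] // h1 h2.
all: by [have := h1 isT | have := h2 isT].
Qed.

(* As [A] is connected, [C] is determined by [cut C :&: A] and by one vertex, so that
   2^|V| <= 2^(|A| + 1). *)
Lemma card_vertex_connected A :
  (forall u v, links A u v) -> (#|vertex G| <= #|A|.+1)%N.
Proof.
move=> con; have [v0 _|V0] := pickP (@predT (vertex G)); last by rewrite (eq_card0 V0).
pose h C := (v0 \in C, cut C :&: A).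
have inj_h : injective h.
  move=> C D [eq0 eqc]; apply/setP => v; pose X := [set x | (x \in C) == (x \in D)].
  (* An edge of [A] leaving [X], the set where [C] and [D] agree, would lie in exactly one of the
     two cuts. *)
  suff : v \in X by rewrite inE => /eqP.
  apply: (links_stay _ _ (con v0 v)); first by rewrite inE eq0.
  apply/setP => e; rewrite !inE; apply/negP => /andP[eA].
  move/setP/(_ e): eqc; rewrite !inE eA !andbT.
  by do 4 case: (_ \in _).
have hA : h @: setT \subset setX [set: bool] (powerset A).
  by apply/subsetP => _ /imsetP[C _ ->]; rewrite !inE subsetIr.
have := subset_leq_card hA.
rewrite card_imset // cardsX card_powerset !cardsT card_bool -expnS.
by rewrite -cardsT -powersetT card_powerset cardsT leq_exp2l.
Qed.

(** A tree of [A] grown from [u] with as many vertices as possible: an edge of [A] leaving [X] would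
    extend it. The bound on [#|EP|] expresses that it has no circuit. *)
Lemma spanning_tree A u : exists (X : {set vertex G}) (EP : {set edge G}),
  [/\ u \in X, EP \subset A :&: inner X, (#|EP| < #|X|)%N,
      (forall x, x \in X -> links EP u x) & (forall x, links A u x -> x \in X)].
Proof.
pose P (z : {set vertex G} * {set edge G}) := 
  [&& u \in z.1, z.2 \subset A :&: inner z.1, (#|z.2| < #|z.1|)%N &
      [forall x in z.1, links z.2 u x]].
have P0 : P ([set u], set0).
  rewrite /P /= set11 sub0set cards0 cards1 /=.
  by apply/forall_inP => x /set1P->; apply: links_refl.
case: (arg_maxnP (fun z : {set vertex G} * {set edge G} => #|z.1|) P0) => -[X EP] /=.
case/and4P=> /= uX sEP ltEP /forall_inP conX max.
exists X, EP; split=> // x ux; apply: contraT => xX.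
have [e eA eX] := links_exit ux uX xX.
have eEP : e \notin EP.
  apply: contraL eX => /(subsetP sEP); rewrite !inE => /andP[_ /andP[-> ->]] //.
pose y := if init e \in X then term e else init e.
have yX : y \notin X by move: eX; rewrite inE /y; case: ifP => // ->.
suff /max /= : P (y |: X, e |: EP) by rewrite cardsU1 yX ltnn.
apply/and4P; split => /=.
- by rewrite inE uX orbT.
- apply/subsetP => e' /setU1P[->|/(subsetP sEP)].
    move: eX; rewrite !inE eA /y.
    by case: ifP => /= iX; rewrite eqxx ?iX ?orbT // => ->; rewrite orbT.
  by rewrite !inE => /andP[-> /andP[-> ->]]; rewrite !orbT.
- by rewrite !cardsU1 yX eEP.
apply/forall_inP => x' /setU1P[->|x'X]; last first.
  exact: links_sub (subsetUr _ _) _ _ (conX _ x'X).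
apply: (@links_trans _ (side X e)).
  exact: links_sub (subsetUr _ _) _ _ (conX _ (cut_side eX)).
have ee := links_edge (setU11 e EP).
by rewrite /side /y; case: ifP => // _; rewrite links_sym.
Qed.

End Links.

(** * Splitting off a connected spanning part *)

Lemma third_element (T : finType) (A : {set T}) h1 h2 :
  (2 < #|A|)%N -> exists2 h, h \in A & (h != h1) && (h != h2).
Proof.
move=> A3; have /card_gt0P[h] : (0 < #|A :\: [set h1; h2]|)%N.
  rewrite cardsD subn_gt0; apply: leq_ltn_trans (subset_leq_card (subsetIr _ _)) _.
  by rewrite cards2; case: (_ != _) => //; apply: ltnW.
by rewrite !inE negb_or => /andP[? ?]; exists h.
Qed.

Section Splitting.
Variable G : ograph.
Implicit Types (u v w x y : vertex G) (e g h s t : edge G).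
Implicit Types (A B F R I : {set edge G}) (C D U K H : {set vertex G}).

Definition far D e : vertex G := if init e \in D then term e else init e.

Lemma cut_far D e : e \in cut D -> far D e \notin D.
Proof. by rewrite inE /far; case: ifP => // ->. Qed.

Lemma links_side_far A D e : e \in A -> links A (side D e) (far D e).
Proof.
move=> eA; have := links_edge eA; rewrite /side /far.
by case: ifP => // _; rewrite links_sym.
Qed.

Lemma far_in_cut C D e : e \in cut D -> side C e \notin D -> far C e \in D.
Proof. by rewrite inE /side /far; case: ifP => _; case: (_ \in D); case: (_ \in D). Qed.

Lemma side_far_inner C D e : (e \in inner D) = (side C e \in D) && (far C e \in D).
Proof. by rewrite inE /side /far; case: ifP; rewrite // andbC. Qed.

Lemma inner_cut0 A D : A \subset inner D -> A :&: cut D = set0.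
Proof.
move=> /subsetP AD; apply/setP=> e; rewrite !inE; apply/negP=> /andP[/AD].
by rewrite inE => /andP[-> ->].
Qed.

(** Let [C] be what [u] reaches in [R] without [cut D]; it misses [D]. If [v] is not in [C], some
    edge [h] of [R] leaves [C]. It lies in [cut D], so it ends in [D], from where [I] leads to [y].
    This route uses no edge of [cut D] other than [h]. *)
Lemma links_reach R I D u y v : I \subset R -> I :&: cut D = set0 ->
  (forall d, d \in D -> links I y d) -> links R u v -> u \notin D ->
  links (R :\: cut D) u v \/
  exists2 h, h \in cut D & forall g, g \in cut D -> g != h -> links (R :\ g) u y.
Proof.
move=> IR I0 yD uv uD; pose C := [set x | links (R :\: cut D) u x].
have [vC|vC] := boolP (v \in C); first by left; rewrite inE in vC.
have uC : u \in C by rewrite inE links_refl.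
have [h hR hC] := links_exit uv uC vC.
have CD x : x \in C -> x \notin D.
  rewrite inE => ux; have := @links_stay _ (R :\: cut D) (~: D) u x.
  rewrite !inE; apply=> //; apply/setP=> e; rewrite !inE.
  by do 2 case: (_ \in D); rewrite ?andbF.
have aC := cut_side hC; have ua : links (R :\: cut D) u (side C h) by move: aC; rewrite inE.
have hD : h \in cut D.
  apply: contraR (cut_far hC) => hD; rewrite inE.
  by apply: links_trans ua (links_side_far _ _); rewrite in_setD hD.
right; exists h => // g gD gh.
have Rg : R :\: cut D \subset R :\ g.
  by rewrite subsetD1 subsetDl in_setD gD.
have Ig : I \subset R :\ g.
  rewrite subsetD1 IR; apply/negP => gI.
  by have := in_set0 g; rewrite -I0 in_setI gI gD.
apply: links_trans (links_sub Rg ua) _; apply: (@links_trans _ _ (far C h)).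
  by apply: links_side_far; rewrite !inE hR eq_sym gh.
rewrite links_sym; apply: (links_sub Ig); apply: yD.
by apply: far_in_cut (CD _ aC).
Qed.

Variable H : {set vertex G}.
Hypothesis cutH : forall D, D != set0 -> D \subset H -> (2 < #|cut D|)%N.
Hypothesis conH : {in H &, forall u v, links (inner H) u v}.

Lemma cutD_cases D h : D \subset H -> h \in cut D -> h \in inner H \/ h \in cut H /\ side H h \in D.
Proof.
move=> sDH hD; have hH := subsetP sDH _ (cut_side hD).
have [fH|fH] := boolP (far D h \in H).
  by left; rewrite (side_far_inner D) hH.
have hcH : h \in cut H.
  by move: hH fH; rewrite inE /side /far; case: ifP => _ -> /negPf->.
by right; rewrite (side_sub sDH) // cut_side.
Qed.

(* Let [D] be a component of [H :\: K].  The connections of [s] and [t] to [D] outside [F]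
   enter [D] through at most two edges of [cut D], which has a third one; hence some edge
   from [D] to [K] can be moved into [F]. *)
Lemma grow K F s t :
    F \subset inner K -> K \proper H -> K != set0 ->
    {in K &, forall u v, links F u v} -> s \in cut H -> t \in cut H -> s != t ->
    links (inner H :\: F) (side H s) (side H t) ->
  exists2 g, g \in inner H :\: F & exists s' t', 
    [/\ g \in cut K, s' \in cut H, t' \in cut H, s' != t' &
    links (inner H :\: (g |: F)) (side H s') (side H t')].
Proof.
move=> FK /properP[KH [z zH zK]] /set0Pn[x xK] conK sH tH st.
pose R := inner H :\: F; rewrite -/R => Rst.
have [g0 g0H g0K] := links_exit (conH (subsetP KH _ xK) zH) xK zK.
pose y := far K g0; have yK : y \notin K := cut_far g0K.
have yH : y \in H by move: g0H; rewrite (side_far_inner K) => /andP[].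
pose I := inner (H :\: K); pose D := [set d | links I y d].
have yD : y \in D by rewrite inE links_refl.
have Iy d : d \in D -> links I y d by rewrite inE.
have D0 : D != set0 by apply/set0Pn; exists y.
have DHK : D \subset H :\: K.
  apply/subsetP=> d /Iy; apply: links_stay; first by rewrite !inE yK.
  exact: inner_cut0.
have DH : D \subset H by apply: subset_trans DHK (subsetDl _ _).
have I0 : I :&: cut D = set0.
  apply/setP=> e; rewrite in_set0; apply/negP=> /setIP[eI eD].
  have := cut_far eD; rewrite inE; case/negP.
  exact: links_trans (Iy _ (cut_side eD)) (links_side_far _ eI).
have innF e : e \in F -> e \in inner K by move/(subsetP FK).
have IR : I \subset R.
  apply/subsetP=> e; rewrite in_setD 2!inE => /andP[].
  rewrite !inE => /andP[ik iH] /andP[tk tH']; rewrite iH tH' !andbT.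
  by apply: contra ik => /innF; rewrite inE => /andP[].
have DR e : e \in cut D -> e \in inner H -> e \in R.
  move=> eD eH; rewrite in_setD eH andbT; apply: contraL (subsetP DHK _ (cut_side eD)) => /innF.
  by rewrite (side_far_inner D) !inE => /andP[->].
have DK e : e \in cut D -> e \in inner H -> e \in cut K.
  move=> eD eH; have aD := cut_side eD.
  have bK : far D e \in K.
    apply: contraR (cut_far eD) => bK; rewrite inE.
    apply: links_trans (Iy _ aD) (links_side_far _ _).
    rewrite (side_far_inner D) (subsetP DHK) //= !inE bK /=.
    by move: eH; rewrite (side_far_inner D) => /andP[].
  have := subsetP DHK _ aD; rewrite !inE => /andP[aK _].
  by move: aK bK; rewrite /side /far; case: ifP => _ /negPf-> ->.
have RgE g : inner H :\: (g |: F) = R :\ g.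
  by apply/setP=> e; rewrite !in_setD in_setU1 negb_or in_set1 andbA.
have g0D : g0 \in cut D.
  have sK := cut_side g0K; have sD : side K g0 \notin D.
    by apply: contraL sK => /(subsetP DHK); rewrite inE => /andP[].
  by move: yD sD; rewrite [g0 \in cut D]inE /y /side /far; case: ifP => _ -> /negPf->.
(* Any [g] in [cut D] inside [H] joins [D] to [K] and can be moved into [F], provided two distinct
   edges of [cut H] have their ends in [H] joined in [R :\ g]. *)
have shift g s' t' : g \in cut D -> g \in inner H -> s' \in cut H -> t' \in cut H -> s' != t' ->
    links (R :\ g) (side H s') (side H t') -> 
  exists2 g, g \in R & exists s' t', 
    [/\ g \in cut K, s' \in cut H, t' \in cut H, s' != t' &
    links (inner H :\: (g |: F)) (side H s') (side H t')].
  move=> gD gH s'H t'H st' L; exists g; first exact: DR.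
  by exists s', t'; rewrite RgE DK.
have Rsub g : g \in cut D -> R :\: cut D \subset R :\ g.
  by move=> gD; rewrite subsetD1 subsetDl in_setD gD.
have Ig g : g \in cut D -> I \subset R :\ g.
  move=> gD; rewrite subsetD1 IR; apply/negP => gI.
  by have := in_set0 g; rewrite -I0 in_setI gI gD.
have Dg g d : g \in cut D -> d \in D -> links (R :\ g) d y.
  by move=> gD /Iy; rewrite links_sym; apply: (links_sub (Ig _ gD)).
(* Only the deletion of [h] among the edges of [cut D] can separate the end of [s'] from [y]. If
   that end is in [D], the choice [h = s'] ensures that an edge of [cut D] other than [h] is not
   [s']. *)
have reach s' v : s' \in cut H -> links R (side H s') v ->
  links (R :\: cut D) (side H s') v \/
  exists h, [/\ h \in cut D, forall g, g \in cut D -> g != h -> links (R :\ g) (side H s') y 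
    & side H s' \in D -> h = s'].
  move=> s'H L; have [s'D|s'D] := boolP (side H s' \in D).
    right; exists s'; split=> //; last by move=> g gD _; apply: Dg.
    have := cut_far s'H => fH; have fD : far H s' \notin D by apply: contra fH; apply: (subsetP DH).
    by move: s'D fD; rewrite [s' \in cut D]inE /side /far; case: ifP => _ -> /negPf->.
  have [?|[h hD hL]] := links_reach IR I0 Iy L s'D; first by left.
  by right; exists h; split=> //; rewrite (negPf s'D).
have [L|[hs [hsD hsL hsE]]] := reach s _ sH Rst.
  by apply: (shift g0 s t) => //; apply: links_sub L; apply: Rsub.
rewrite links_sym in Rst; have [L|[ht [htD htL htE]]] := reach t _ tH Rst.
  by apply: (shift g0 s t) => //; rewrite links_sym; apply: links_sub L; apply: Rsub.
have glue g u v : links (R :\ g) u y -> links (R :\ g) v y -> links (R :\ g) u v.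
  by rewrite [links _ v y]links_sym; apply: links_trans.
have card3 := cutH D0 DH.
have pick3 h1 h2 : exists2 h, h \in cut D & (h != h1) && (h != h2).
  exact: third_element.
(* If [h] lies inside [H], it is moved. Otherwise it leaves [H] from [D] and can replace [t] or [s]
   while [g0] is moved. If [g0] is critical for both [s] and [t], a further edge [h'] is moved or
   forms the new pair with [h]. *)
have [h hD /andP[hhs hht]] := pick3 hs ht.
have [hH|[hH hHD]] := cutD_cases DH hD.
  by apply: (shift h s t) => //; apply: glue; [apply: hsL | apply: htL].
have hg0 : g0 != h.
  apply: contraTneq hH => <-; move: g0H; rewrite !inE.
  by do 2 case: (_ \in H).
have [g0s|g0s] := eqVneq g0 hs; last first.
  apply: (shift g0 h s) => //.
    by apply: contraNneq hhs => hs'; rewrite hsE -?hs' // hs'.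
  by apply: glue; [apply: Dg | apply: hsL].
have [g0t|g0t] := eqVneq g0 ht; last first.
  apply: (shift g0 h t) => //.
    by apply: contraNneq hht => hs'; rewrite htE -?hs' // hs'.
  by apply: glue; [apply: Dg | apply: htL].
have [h' h'D /andP[h'g0 h'h]] := pick3 g0 h.
have [h'H|[h'H h'HD]] := cutD_cases DH h'D.
  apply: (shift h' s t) => //; apply: glue; [apply: hsL | apply: htL] => //.
    by rewrite -g0s.
  by rewrite -g0t.
apply: (shift g0 h' h) => //.
by apply: glue; apply: Dg.
Qed.

(** Start with [K] a single vertex, [F] empty and any two edges of [cut H]. Each use of [grow] adds
    a vertex to [K] and an edge to [F], until [K] is [H]; the pair [s], [t] may change on the
    way. *)
Lemma splitting : H != set0 -> exists F : {set edge G}, exists s t,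
  [/\ F \subset inner H, {in H &, forall u v, links F u v}, 
      s \in cut H, t \in cut H & s != t /\
      links (inner H :\: F) (side H s) (side H t)].
Proof.
move=> H0; have := cutH H0 (subxx _) => c3.
have [x xH] := set0Pn _ H0.
suff main n K F s t : (#|H :\: K| <= n)%N -> 
    F \subset inner K -> K \subset H -> K != set0 ->
    {in K &, forall u v, links F u v} -> s \in cut H -> t \in cut H -> s != t ->
    links (inner H :\: F) (side H s) (side H t) ->
  exists F : {set edge G}, exists s t,
  [/\ F \subset inner H, {in H &, forall u v, links F u v}, 
      s \in cut H, t \in cut H & s != t /\
      links (inner H :\: F) (side H s) (side H t)].
  have [s sH] : exists s, s \in cut H by apply/set0Pn; rewrite -card_gt0; apply: leq_trans c3.
  have [t] : exists t, t \in cut H :\ s.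
    by apply/set0Pn; rewrite -card_gt0; move: c3; rewrite (cardsD1 s) sH; lia.
  rewrite in_setD1 eq_sym => /andP[st tH].
  apply: (main _ [set x] set0 s t (leqnn _)); rewrite ?sub0set ?sub1set //.
  - by apply/set0Pn; exists x; rewrite set11.
  - by move=> u v /set1P-> /set1P->; apply: links_refl.
  by rewrite setD0; apply: conH; apply: cut_side.
elim: n K F s t => [|n IHn] K F s t cn FK KH K0 conK sH tH st Rst.
  have HK : H = K.
    by apply/eqP; rewrite eqEsubset KH andbT -setD_eq0 -cards_eq0 -leqn0.
  by move: conK FK; rewrite -HK => conK FK; exists F, s, t.
have [HK|HK] := boolP (K \proper H); last first.
  apply: (IHn K F s t) => //.
  by move: HK; rewrite properEneq KH andbT negbK => /eqP->; rewrite setDv cards0.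
have [g gR [s' [t' [gK s'H t'H st' L]]]] := grow FK HK K0 conK sH tH st Rst.
have sK := cut_side gK; have fK := cut_far gK.
have fH : far K g \in H.
  by move: gR; rewrite in_setD (side_far_inner K) => /and3P[].
apply: (IHn (far K g |: K) (g |: F) s' t') => //.
- have -> : H :\: (far K g |: K) = (H :\: K) :\ far K g.
    by apply/setP=> v; rewrite !inE negb_or andbA.
  by move: cn; rewrite (cardsD1 (far K g)) in_setD fK fH.
- apply/subsetP=> e /setU1P[->|/(subsetP FK)].
    by rewrite (side_far_inner K) !inE eqxx sK orbT.
  exact: (subsetP (inner_sub (subsetUr _ _))).
- by rewrite subUset sub1set fH.
- by apply/set0Pn; exists (far K g); rewrite setU11.
suff to u : u \in far K g |: K -> links (g |: F) (side K g) u.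
  by move=> u v /to ? /to; apply: links_trans; rewrite links_sym.
move=> /setU1P[->|uK]; first exact/links_side_far/setU11.
exact: links_sub (subsetUr _ _) _ _ (conK _ _ sK uK).
Qed.

End Splitting.

(** * Eulerian orientations *)

Lemma oddzD (x y : int) : odd (absz (x + y)) = odd (absz x) (+) odd (absz y).
Proof. by lia. Qed.

(* By induction on [J]: two edges meeting at [v] are replaced by a single edge bypassing [v]. *)
Lemma euler_orientation (V E : finType) (J : {set E}) (a b : E -> V) :
  (forall v, \big[addb/false]_(e in J) ((a e == v) (+) (b e == v)) = false) ->
  exists sg : E -> bool, forall v,
    \sum_(e in J) (-1) ^+ sg e * ((a e == v)%:R - (b e == v)%:R) = 0 :> int.
Proof.
have [n] := ubnP #|J|; elim: n J a b => // n IHn J a b.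
have [->|[e eJ]] := set_0Vmem J.
  by move=> _ _; exists xpredT => v; rewrite big_set0.
rewrite (cardsD1 e) eJ ltnS => ltJ even_ab.
have [loop|nloop] := eqVneq (a e) (b e).
  have [|sg sgP] := IHn (J :\ e) a b ltJ.
    by move=> v; have := even_ab v; rewrite (big_setD1 e) //= loop addbb.
  by exists sg => v; rewrite (big_setD1 e) //= sgP loop subrr mulr0 add0r.
have [e' e'J e'b] : exists2 e', e' \in J :\ e & (a e' == b e) (+) (b e' == b e).
  apply/exists_inP; apply: contraFT (even_ab (b e)) => /exists_inPn no.
  rewrite (big_setD1 e) //= eqxx (negPf nloop) big1 // => e' e'J.
  exact/negbTE/no.
have [e'e e'J0] : e' != e /\ e' \in J by move: e'J; rewrite !inE => /andP[].
(* The edge [e] is redirected to [c], the other end of [e'], and so stands for [e] followed by [e'];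
   [s] is set if [e'] is then run backwards. *)
pose c := if a e' == b e then b e' else a e'.
have cE v : (a e' == v) (+) (b e' == v) = (b e == v) (+) (c == v).
  by rewrite /c; case: ifP e'b => [/eqP-> //|_ /= /eqP->]; rewrite addbC.
pose s := a e' != b e.
have sE v : (-1) ^+ s * ((a e' == v)%:R - (b e' == v)%:R) = (b e == v)%:R - (c == v)%:R :> int.
  rewrite /s /c; case: ifP e'b => [/eqP->|_ /= /eqP->]; first by rewrite mul1r.
  by rewrite mulN1r opprB.
have [| |sg sgP] := IHn (J :\ e') a (fun x => if x == e then c else b x).
- by have := cardsD1 e' J; rewrite (cardsD1 e J) eJ e'J0 => /addnI <-.
- move=> v; rewrite -[RHS](even_ab v) [RHS](big_setD1 e) //= [in RHS](big_setD1 e') //=.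
  rewrite (big_setD1 e) ?inE ?[e == e']eq_sym ?e'e //= eqxx.
  rewrite cE -!addbA; congr addb.
  rewrite [in RHS]addbA addbb /=; congr addb.
  by apply: eq_big => x; rewrite !inE andbCA // => /and3P[_ /negPf->].
exists (fun x => if x == e' then s (+) sg e else sg x) => v.
rewrite (big_setD1 e') //= eqxx signr_addb [_ ^+ s * _]mulrC -mulrA sE.
rewrite -[RHS](sgP v) (big_setD1 e) /=; last by rewrite !inE eq_sym e'e.
rewrite [in RHS](big_setD1 e) /=; last by rewrite !inE eq_sym e'e.
rewrite eqxx [e == e']eq_sym (negPf e'e) addrA -mulrDr; congr (_ * _ + _).
  by rewrite addrC subrKA.
by apply: eq_bigr => x; rewrite !inE => /and3P[/negPf-> /negPf-> _].
Qed.

(** * Flows *)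

Section Flows.
Variable G : ograph.
Implicit Types (u v w : vertex G) (e : edge G) (A B F N : {set edge G}) (U : {set vertex G}).

Definition inc e v : int := (init e == v)%:R - (term e == v)%:R.

(** Outflow minus inflow. A general group [M] covers both flows in [Gamma] and integer circuits,
    whose multiples by elements of [Gamma] are added to them. *)
Definition boundary (M : zmodType) (phi : edge G -> M) v : M := \sum_e phi e *~ inc e v.

Lemma is_flowP (M : zmodType) (phi : {ffun edge G -> M}) :
  reflect (forall v, boundary phi v = 0) (is_flow phi).
Proof.
have E v : boundary phi v = \sum_(e in out_edges v) phi e - \sum_(e in in_edges v) phi e.
  rewrite [X in _ = X - _]big_mkcond [X in _ = _ - X]big_mkcond -sumrB.
  apply: eq_bigr => e _; rewrite mulrzBr !inE.
  by do 2 case: (_ == v).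
apply: (iffP forallP) => H v; first by rewrite E (eqP (H v)) subrr.
by rewrite -subr_eq0 -E H.
Qed.

Lemma boundaryD (M : zmodType) (f g : edge G -> M) v :
  boundary (fun e => f e + g e) v = boundary f v + boundary g v.
Proof. by rewrite -big_split; apply: eq_bigr => e _; rewrite mulrzDl. Qed.

Lemma boundaryN (M : zmodType) (f : edge G -> M) v :
  boundary (fun e => - f e) v = - boundary f v.
Proof. by rewrite -sumrN; apply: eq_bigr => e _; rewrite mulNrz. Qed.

Lemma boundary_sum (M : zmodType) (I : finType) (P : pred I) (f : I -> edge G -> M) v :
  boundary (fun e => \sum_(i | P i) f i e) v = \sum_(i | P i) boundary (f i) v.
Proof. by rewrite exchange_big; apply: eq_bigr => e _; rewrite mulrz_suml. Qed.

Lemma boundaryZ (M : zmodType) (x : M) (D : edge G -> int) v :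
  boundary (fun e => x *~ D e) v = x *~ boundary D v.
Proof. by rewrite mulrz_sumr; apply: eq_bigr => e _; rewrite mulrzz mulrzA. Qed.

Lemma boundary_delta e v : boundary (fun e' => (e' == e)%:R : int) v = inc e v.
Proof.
rewrite /boundary (bigD1 e) //= eqxx mulrzz mul1r big1 ?addr0 // => e' /negPf->.
by rewrite mul0rz.
Qed.

(** A path from [u] to [v], each edge counted with the direction in which it is run; closing it up
    gives the circuits used below. *)
Lemma unit_flow A u v : links A u v -> exists p : edge G -> int,
  (forall e, e \notin A -> p e = 0) /\
  forall w, boundary p w = (u == w)%:R - (v == w)%:R.
Proof.
case/connectP => q; elim: q u => [|x q IHq] u /=.
  move=> _ ->; exists (fun=> 0); split=> // w.
  by rewrite subrr /boundary big1 // => e _; rewrite mul0rz.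
case/andP=> /existsP[e]; rewrite inE negbK => /andP[eA ux] xq vq.
have [p [p0 pw]] := IHq x xq vq.
pose s : int := if (init e == u) && (term e == x) then 1 else -1.
exists (fun e' => s *~ (e' == e)%:R + p e'); split=> [e' e'A | w].
  by rewrite p0 // addr0; case: eqP e'A => [->|]; rewrite ?eA // mulr0z.
rewrite boundaryD boundaryZ boundary_delta pw /s /inc.
case: ifP ux => [/andP[/eqP-> /eqP->] _|_ /= /andP[/eqP-> /eqP->]].
  by rewrite mulrzz mul1r addrA subrK.
by rewrite mulrzz mulN1r opprB addrA subrK.
Qed.

(* The odd part of the flow obtained by closing up each edge of [B] through [A]
   is an even subgraph, hence has an Eulerian orientation. *)
Lemma signed_flow A B : (forall u v, links A u v) -> B \subset ~: A ->
  exists chi : edge G -> int, [/\ forall v, boundary chi v = 0,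
    forall e, (absz (chi e) <= 1)%N &
    forall e, e \notin A -> (chi e != 0) = (e \in B)].
Proof.
move=> conA BA.
have /fin_all_exists[p pP] e := unit_flow (conA (term e) (init e)).
pose X e' : int := \sum_(e in B) ((e' == e)%:R + p e e').
have bX v : boundary X v = 0.
  rewrite boundary_sum big1 // => e _; rewrite boundaryD boundary_delta (pP e).2 /inc.
  by rewrite addrA subrK subrr.
have XB e : e \notin A -> X e = (e \in B)%:R.
  move=> eA; rewrite /X (eq_bigr (fun e' => (e == e')%:R)); last first.
    by move=> e' _; rewrite (pP e').1 // addr0.
  have [eB|eB] := boolP (e \in B).
    by rewrite (bigD1 e) //= eqxx big1 ?addr0 // => e' /andP[_]; rewrite eq_sym => /negPf->.
  by rewrite big1 // => e' e'B; case: eqP eB => // ->; rewrite e'B.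
pose J := [set e | odd (absz (X e))].
have [v|sg sgP] := @euler_orientation _ _ J (@init G) (@term G).
  have : odd (absz (boundary X v)) = false by rewrite bX.
  rewrite (big_morph (fun z => odd (absz z)) (id1 := false) oddzD) // => odd0.
  rewrite -[RHS]odd0 [LHS]big_mkcond; apply: eq_bigr => e _; rewrite mulrzz abszM oddM inE /inc.
  by case: (odd _) => //=; do 2 case: (_ == v).
exists (fun e => if e \in J then (-1) ^+ sg e else 0); split=> [v|e|e eA].
- rewrite -[RHS](sgP v) [RHS]big_mkcond; apply: eq_bigr => e _.
  by case: ifP; rewrite ?mul0rz // mulrzz.
- by case: ifP; rewrite // absz_sign.
by rewrite inE XB //; case: (e \in B) => //=; rewrite signr_eq0.
Qed.

(** * Counting flows with forbidden values *)

Section Counting.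
Variables (Gamma : finZmodType) (forb : edge G -> {set Gamma}) (c q : nat).
Hypothesis forb_q : forall e, (#|forb e| <= q)%N.
Hypothesis cq : (c + q.*2 <= #|Gamma|)%N.

Definition avoiders A F (psi0 : {ffun edge G -> Gamma}) :=
  [set psi : {ffun edge G -> Gamma} | [&& is_flow psi, [forall e in ~: F, psi e == psi0 e]
     & [forall e in A, psi e \notin forb e]]].

Lemma avoidersP A F (psi0 psi : {ffun edge G -> Gamma}) : reflect [/\ is_flow psi, 
    forall e, e \notin F -> psi e = psi0 e & forall e, e \in A -> psi e \notin forb e]
  (psi \in avoiders A F psi0).
Proof.
rewrite inE; apply: (iffP and3P) => -[Hf HF HA]; split=> //.
- by move=> e eF; apply/eqP/(forall_inP HF); rewrite inE.
- exact/forall_inP.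
- by apply/forall_inP => e; rewrite inE => /HF->.
exact/forall_inP.
Qed.

(** Quantifying over [psi0] lets a circuit be added first and the flow be adjusted inside [F]
    afterwards. *)
Definition many A F m :=
  forall psi0 : {ffun edge G -> Gamma}, is_flow psi0 -> (c ^ m <= #|avoiders A F psi0|)%N.

Lemma many0 : many set0 set0 0.
Proof.
move=> psi0 psi0P; rewrite expn0; apply/card_gt0P; exists psi0.
by apply/avoidersP; split=> // e; rewrite inE.
Qed.

(** When [x] times [D] is added, each of the at most two edges of [N] excludes at most [q] values of
    [x], as [D] is 1 or -1 there; at least [c] values remain. Adjusting inside [F] does not touch
    [N], and the value on an edge of [N] determines [x], so different [x] give disjoint families. *)
Lemma many_step A F N F' (D : edge G -> int) m : A \subset F -> 
    (0 < #|N|)%N -> (#|N| <= 2)%N -> [disjoint N & F] -> F :|: N \subset F' ->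
    (forall v, boundary D v = 0) -> (forall e, e \notin F' -> D e = 0) ->
    (forall e, e \in N -> absz (D e) = 1%N) ->
  many A F m -> many (A :|: N) F' m.+1.
Proof.
move=> AF N0 N2 NF FF' bD DF' DN IH psi0 psi0P.
pose psi x := [ffun e => psi0 e + x *~ D e].
have psiP x : is_flow (psi x).
  apply/is_flowP => v; rewrite /boundary; under eq_bigr do rewrite ffunE.
  rewrite -/(boundary (fun e => psi0 e + x *~ D e) v) boundaryD boundaryZ bD.
  by rewrite mulr0z addr0; apply/is_flowP.
pose X := [set x | [forall e in N, psi x e \notin forb e]].
have DD e (x : Gamma) : e \in N -> x *~ D e *~ D e = x.
  by move=> /DN; rewrite -mulrzA; case: (D e) => [[|[|n]]|[|n]].
have cX : (c <= #|X|)%N.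
  have : (#|~: X| <= q.*2)%N.
    have XN : ~: X \subset \bigcup_(e in N) [set x | psi x e \in forb e].
      apply/subsetP => x; rewrite !inE negb_forall => /existsP[e].
      rewrite negb_imply negbK => /andP[eN xe].
      by apply/bigcupP; exists e; rewrite // inE.
    apply: leq_trans (subset_leq_card XN) _.
    apply: (@leq_trans (\sum_(e in N) q)); last first.
      by rewrite sum_nat_const -mul2n leq_mul2r N2 orbT.
    elim/big_ind2 : _ => [|A1 n1 A2 n2 h1 h2|e eN]; first by rewrite cards0.
      by apply: leq_trans (leq_card_setU _ _) _; apply: leq_add.
    apply: leq_trans (forb_q e).
    have inj : injective (fun x => psi x e).
      by move=> x y; rewrite !ffunE => /addrI/(congr1 ( *~%R^~ (D e))); rewrite !DD.
    rewrite -(card_imset _ inj) subset_leq_card //.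
    by apply/subsetP=> _ /imsetP[x /[!inE] ? ->].
  move=> XC; rewrite -(leq_add2r #|~: X|) cardsC.
  by apply: leq_trans cq; rewrite leq_add2l.
have [e0 e0N] := card_gt0P N0.
pose key (phi : {ffun edge G -> Gamma}) := (phi e0 - psi0 e0) *~ D e0.
rewrite expnS; apply: leq_trans (leq_mul cX (leqnn _)) _.
rewrite -[leqRHS]sum1_card (partition_big key predT) //= -sum_nat_const big_mkcond /=.
apply: leq_sum => x _; case: ifP => // xX.
apply: leq_trans (IH _ (psiP x)) _; rewrite sum1_card subset_leq_card //.
apply/subsetP=> phi /avoidersP[phi_flow phiF phiA]; rewrite unfold_in /=.
have phiN e : e \in N -> phi e = psi x e by move=> eN; rewrite phiF // (disjointFr NF).
apply/andP; split; last by rewrite /key phiN // ffunE addrAC subrr add0r DD.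
apply/avoidersP; split=> // [e eF'|e /setUP[/phiA//|eN]].
  rewrite phiF; first by rewrite ffunE DF' // mulr0z addr0.
  by apply: contra eF' => eF; rewrite (subsetP FF') // inE eF.
by rewrite phiN //; move: xX; rewrite inE => /forall_inP; apply.
Qed.

Lemma many_weaken A F F' m : F \subset F' -> many A F m -> many A F' m.
Proof.
move=> FF' IH psi0 psi0P; apply: leq_trans (IH _ psi0P) _.
apply/subset_leq_card/subsetP => phi /avoidersP[phiP phiF phiA].
by apply/avoidersP; split=> // e eF'; apply/phiF; apply: contra eF'; apply: (subsetP FF').
Qed.

Lemma many_edge A F e m : A \subset F -> e \notin F -> links F (init e) (term e) ->
  many A F m -> many (e |: A) (e |: F) m.+1.
Proof.
move=> AF eF; rewrite links_sym => /unit_flow[p [p0 pb]].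
rewrite !(setUC [set e]).
apply: (@many_step _ _ _ _ (fun e' => (e' == e)%:R + p e')); rewrite ?cards1 ?disjoints1 //.
- by move=> v; rewrite boundaryD boundary_delta pb /inc addrA subrK subrr.
- by move=> e' /[!inE] /norP[e'F /negPf->]; rewrite p0.
by move=> e' /set1P->; rewrite eqxx p0.
Qed.

(** As [F] connects [U], each further edge inside [U] closes a circuit through [F] and gives another
    factor [c]. *)
Lemma many_inner A F U m : A \subset F -> F \subset inner U ->
    {in U &, forall u v, links F u v} -> many A F m ->
  many (A :|: inner U :\: F) (inner U) (m + #|inner U :\: F|).
Proof.
have [n] := ubnP #|inner U :\: F|; elim: n A F m => // n IHn A F m ltn AF FU conU AFm.
have [F0|[e]] := set_0Vmem (inner U :\: F).
  by rewrite F0 setU0 cards0 addn0; apply: many_weaken AFm.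
rewrite inE => /andP[eF eU]; have := eU; rewrite inE => /andP[iU tU].
have setE : inner U :\: F = e |: (inner U :\: (e |: F)).
  by apply/setP=> e'; rewrite !in_setU1 !in_setD in_setU1; case: eqVneq => [->|//]; rewrite eF eU.
have cardE : #|inner U :\: F| = #|inner U :\: (e |: F)|.+1.
  by rewrite setE cardsU1 in_setD setU11.
rewrite setE -setE cardE setE setUCA setUA addnS -addSn.
apply: IHn; first by rewrite -ltnS -cardE.
- exact: setUS.
- by rewrite subUset sub1set eU.
- by move=> u v uU vU; apply: links_sub (subsetUr _ _) _ _ (conU _ _ uU vU).
by apply: many_edge => //; apply: conU.
Qed.

End Counting.

(** * Enlarging the vertex set *)

Lemma edge_flow (C : {set vertex G}) e : exists p : edge G -> int,
  [/\ forall e', e' != e -> p e' = 0, absz (p e) = 1%N &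
      forall v, boundary p v = (side C e == v)%:R - (far C e == v)%:R].
Proof.
pose s : int := if init e \in C then 1 else -1.
exists (fun e' => s *~ (e' == e)%:R); split=> [e' /negPf->|| v].
- by rewrite mulr0z.
- by rewrite eqxx /s; case: ifP.
rewrite boundaryZ boundary_delta mulrzz /s /side /far /inc.
by case: ifP; rewrite ?mul1r // mulN1r opprB.
Qed.

(** The boundary of a circuit made of an edge from [x] to [y], a path from [y] to [w], an edge from
    [z] to [w] run backwards, and a path from [z] to [x]. *)
Lemma telescope4 (x y z w : int) : x - y - (z - w) + (y - w + (z - x)) = 0.
Proof. lia. Qed.

Section Growth.
Variables (Gamma : finZmodType) (forb : edge G -> {set Gamma}) (c q : nat).
Hypothesis forb_q : forall e, (#|forb e| <= q)%N.
Hypothesis cq : (c + q.*2 <= #|Gamma|)%N.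
Local Notation many := (many forb c).

(* The bound on [m] says that it is at least the cyclomatic number of the graph induced on [U]. *)
Record stage U A : Prop := Stage {
  stage_inner : A \subset inner U;
  stage_compl : forall u v, links (~: A) u v;
  stage_links : {in U &, forall u v, links (inner U) u v};
  stage_many : exists2 m, many (inner U :\: A) (inner U) m & (#|inner U| < m + #|U|)%N }.

Hypothesis cut3 : forall D : {set vertex G}, D != set0 -> D != setT -> (2 < #|cut D|)%N.

(** A tree [EP] in the rest of [H] joins the ends of [s] and [t]. Put [EP] into [S] and its vertex
    set [X] into [U]: then [s] and [t] are the only edges not yet reached of a circuit through [U]
    and [EP], and the other new edges close up circuits one at a time. *)
Lemma stage_grow U S : stage U S -> U != set0 -> U != setT ->
  exists U' S', stage U' S' /\ (#|U| < #|U'|)%N.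
Proof.
case=> SU conS conU [m Um leU] U0.
rewrite -subTset => /subsetPn[z _ zU].
pose H := [set v | links (inner (~: U)) z v].
have HU : H \subset ~: U.
  apply/subsetP=> v; rewrite [v \in H]inE.
  by apply: links_stay; [rewrite inE | apply: inner_cut0].
have zH : z \in H by rewrite inE links_refl.
have H0 : H != set0 by apply/set0Pn; exists z.
have innerHU e : e \in inner H -> e \notin inner U.
  rewrite inE => /andP[iH _]; rewrite inE negb_and.
  by have := subsetP HU _ iH; rewrite inE => ->.
have linksz h : h \in H -> links (inner H) z h.
  move=> hH; apply: contraT => nzh; pose C := [set v | links (inner H) z v].
  have zC : z \in C by rewrite inE links_refl.
  have CH : C \subset H.
    by apply/subsetP=> v; rewrite inE; apply: (links_stay zH); apply: inner_cut0.
  have hC : h \notin C by rewrite inE.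
  have [|e eU eC] := @links_exit _ (inner (~: U)) C z h _ zC hC; first by rewrite inE in hH.
  have sC := cut_side eC; case/negP: (cut_far eC).
  have sH := subsetP CH _ sC.
  have fH : far C e \in H.
    by move: sH; rewrite !inE => /links_trans; apply; apply: links_side_far.
  have := sC; rewrite !inE => /links_trans; apply; apply: links_side_far.
  by rewrite (side_far_inner C) sH.
have conH : {in H &, forall u v, links (inner H) u v}.
  by move=> u v /linksz zu /linksz; apply: links_trans; rewrite links_sym.
have cutH D : D != set0 -> D \subset H -> (2 < #|cut D|)%N.
  move=> D0 DH; apply: cut3 => //.
  have [u uU] := set0Pn _ U0; apply: contraTneq uU => DT.
  by have := subsetP (subset_trans DH HU) u; rewrite DT !inE => ->.
have farU e : e \in cut H -> far H e \in U.
  move=> eH; have sH := cut_side eH; apply: contraR (cut_far eH) => fU.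
  have := sH; rewrite !inE => /links_trans; apply; apply: links_side_far.
  by rewrite (side_far_inner H) (subsetP HU) // inE.
have cutH_U e : e \in cut H -> e \notin inner U.
  move=> /cut_side/(subsetP HU); rewrite inE (side_far_inner H).
  by move/negPf->.
have cutH_H e : e \in cut H -> e \notin inner H.
  by move=> /cut_far/negPf fH; rewrite (side_far_inner H) fH andbF.
have [F [s [t [FH conF sH tH [st Rst]]]]] := splitting cutH conH H0.
have [X [EP [aX EPX ltEP conX X_max]]] := spanning_tree (inner H :\: F) (side H s).
have bX := X_max _ Rst.
have EPH e : e \in EP -> e \in inner H by move/(subsetP EPX); rewrite inE in_setD => /andP[/andP[]].
have EPF e : e \in EP -> e \notin F by move/(subsetP EPX); rewrite inE in_setD => /andP[/andP[]].
have EPiX e : e \in EP -> e \in inner X by move/(subsetP EPX); rewrite inE => /andP[].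
have XH : X \subset H.
  apply/subsetP=> x /conX; apply: links_stay; first exact: cut_side.
  by apply: inner_cut0; apply/subsetP.
have XU : [disjoint U & X].
  by rewrite disjoint_sym disjoints_subset; apply: subset_trans XH HU.
have Sinn e : e \in S -> e \in inner U by apply: (subsetP SU).
have sEP e : e \in cut H -> e \notin EP by move=> eH; apply: contra (cutH_H _ eH) => /EPH.
pose N := [set s; t]; pose F' := inner U :|: EP :|: N.
have NH e : e \in N -> e \in cut H by case/set2P => ->.
have [ps [ps0 ps1 psb]] := edge_flow H s.
have [pt [pt0 pt1 ptb]] := edge_flow H t.
have [pu [pu0 pub]] := unit_flow (conU _ _ (farU _ sH) (farU _ tH)).
have [px [px0 pxb]] := unit_flow (links_trans (etrans (links_sym _ _ _) (conX _ bX)) (conX _ aX)).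
pose D e := (ps e - pt e) + (pu e + px e).
have F'm : many (inner U :\: S :|: N) F' m.+1.
  apply: (many_step forb_q cq (D := D)) Um.
  - exact: subsetDl.
  - by rewrite cards2.
  - by rewrite cards2; case: (s != t).
  - rewrite disjoints_subset; apply/subsetP=> e /NH/cutH_U; by rewrite in_setC.
  - by rewrite /F' setUAC subsetUl.
  - by move=> v; rewrite !boundaryD boundaryN psb ptb pub pxb telescope4.
  - move=> e; rewrite /F' !in_setU in_set1 in_set1 !negb_or -andbA => /and4P[eU eEP es et].
    by rewrite /D ps0 // pt0 // pu0 // px0.
  move=> e eN; rewrite /D pu0 ?px0 ?sEP ?cutH_U ?NH // !addr0.
  case/set2P: eN => ->; first by rewrite (pt0 s st) subr0.
  by rewrite ps0 1?eq_sym // sub0r abszN.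
have F'E e : (e \in F') = [|| e \in inner U, e \in EP | e \in N].
  by rewrite /F' in_setU in_setU orbA.
have F'U' : F' \subset inner (U :|: X).
  rewrite !subUset; apply/andP; split; first apply/andP; first split.
  - exact/inner_sub/subsetUl.
  - by apply/subsetP=> e /EPiX; apply: (subsetP (inner_sub (subsetUr _ _))).
  apply/andP; split; rewrite sub1set (side_far_inner H) !inE farU ?orbT //=.
    by rewrite aX orbT.
  by rewrite bX orbT.
have linka u : u \in U :|: X -> links F' (side H s) u.
  case/setUP=> [uU|uX]; last first.
    apply: links_sub (conX _ uX); apply: subset_trans (subsetUl _ N).
    exact: subsetUr.
  apply: (@links_trans _ _ (far H s)).
    by apply: links_side_far; rewrite !in_setU !in_set1 eqxx orbT.
  apply: links_sub (conU _ _ (farU _ sH) uU).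
  by rewrite /F' -setUA subsetUl.
have conF' : {in U :|: X &, forall u v, links F' u v}.
  by move=> u v /linka ? /linka; apply: links_trans; rewrite links_sym.
exists (U :|: X), (S :|: EP); split; last first.
  by rewrite cardsU disjoint_setI0 // cards0 subn0 -addn1 leq_add2l; apply: leq_trans ltEP.
split.
- rewrite subUset; apply/andP; split; apply/subsetP=> e.
    by move/Sinn; apply: (subsetP (inner_sub (subsetUl _ _))).
  by move/EPiX; apply: (subsetP (inner_sub (subsetUr _ _))).
(* The edges of [EP] run inside [H], where [F] replaces them in the complement of [S :|: EP]. *)
- move=> u v; apply: links_subst (conS u v) => e; rewrite inE => eS.
  have [eEP|eEP] := boolP (e \in EP); last first.
    by apply: links_edge; rewrite inE in_setU negb_or eS.
  have := EPH _ eEP; rewrite inE => /andP[iH tH'].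
  apply: links_sub (conF _ _ iH tH'); apply/subsetP=> e' e'F.
  rewrite inE in_setU negb_or; apply/andP; split.
    by apply: contraL (subsetP FH _ e'F) => /Sinn/(contraL (innerHU _)); apply.
  by apply: contraL e'F; apply: EPF.
- by move=> u v uU vU; apply: links_sub F'U' _ _ (conF' _ _ uU vU).
have AF' : inner U :\: S :|: N \subset F'.
  by rewrite /F' setUAC; apply: subset_trans (subsetUl _ _); apply: setSU; apply: subsetDl.
(* One for the circuit through [s] and [t], and one for each remaining edge. That circuit reaches
   two edges at once; the bound survives because [#|EP| < #|X|]. *)
exists (m.+1 + #|inner (U :|: X) :\: F'|)%N.
  have := many_inner forb_q cq AF' F'U' conF' F'm.
  congr (many _ _ _); apply/setP=> e; rewrite 2!in_setU 3!in_setD [e \in S :|: EP]in_setU F'E.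
  have [eN|eN] := boolP (e \in N).
    rewrite orbT /= (negPf (sEP _ (NH _ eN))) orbF (contraNF (@Sinn e)) ?cutH_U ?NH //=.
    by rewrite (subsetP F'U') // /F' in_setU eN orbT.
  have [eEP|eEP] := boolP (e \in EP).
    by rewrite (negPf (innerHU _ (EPH _ eEP))) !orbT andbF.
  rewrite !orbF; have [eU|eU] := boolP (e \in inner U).
    by rewrite (subsetP (inner_sub (subsetUl _ _)) _ eU) orbF.
  by rewrite (contraNF (@Sinn e)).
rewrite -(cardsID F' (inner (U :|: X))) (setIidPr F'U').
rewrite [#|U :|: X|]cardsU disjoint_setI0 // cards0 subn0.
have cF' : (#|F'| <= #|inner U| + #|EP| + 2)%N.
  apply: leq_trans (leq_card_setU _ _) _; rewrite leq_add //; last first.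
    by rewrite cards2; case: (_ != _).
  exact: leq_card_setU.
clear -cF' ltEP leU; lia.
Qed.

End Growth.
End Flows.

(** * Reaching all vertices and counting flows *)

Lemma edge_connected_cut (G : ograph) k (D : {set vertex G}) :
  edge_connected k G -> D != set0 -> D != setT -> (k <= #|cut D|)%N.
Proof.
move=> [_ hG] /set0Pn[u uD]; rewrite -subTset => /subsetPn[v _ vD].
rewrite leqNgt; apply: contra vD => /hG/(_ u v) uv.
apply: (@links_stay _ (~: cut D) D u) => //; first by rewrite setIC setICr.
by rewrite /links setCK.
Qed.

(** Start from one vertex with [S] empty, where the only inner edges are loops, each a circuit by
    itself, and apply [stage_grow] until [U] is everything. *)
Lemma stage_exists (G : ograph) (Gamma : finZmodType) (forb : edge G -> {set Gamma}) c q :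
    (forall e, #|forb e| <= q)%N -> (c + q.*2 <= #|Gamma|)%N -> edge_connected 3 G ->
  exists S, stage forb c setT S.
Proof.
move=> forb_q cq hG; have [V2 conG] := hG.
suff main n U S : (#|~: U| <= n)%N -> U != set0 -> stage forb c U S ->
    exists S, stage forb c setT S.
  have [v0 _] : exists v : vertex G, v \in predT by apply/card_gt0P; apply: ltnW.
  have con1 : {in [set v0] &, forall u v, @links G set0 u v}.
    by move=> u v /set1P-> /set1P->; apply: links_refl.
  apply: (main _ [set v0] set0 (leqnn _)); first by apply/set0Pn; exists v0; rewrite set11.
  split; first exact: sub0set.
  - by move=> u v; rewrite /links setCK; apply: conG; rewrite cards0.
  - by move=> u v uU vU; apply: links_sub (sub0set _) _ _ (con1 _ _ uU vU).
  have := many_inner forb_q cq (sub0set set0) (sub0set (inner [set v0])) con1 (many0 _ _).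
  rewrite set0U setD0 => inn; exists #|inner [set v0]|; first by [].
  by rewrite cards1 addn1.
elim: n U S => [|n IHn] U S; have [->|UT] := eqVneq U setT; try by exists S.
  by rewrite leqn0 cards_eq0 => /eqP UC; case/eqP: UT; rewrite -[U]setCK UC setC0.
move=> Un U0 US.
have [D D0 DT|U' [S' [US' ltU]]] := stage_grow forb_q cq _ US U0 UT.
  exact: edge_connected_cut.
apply: (IHn U' S') => //.
  by rewrite -ltnS; apply: leq_trans Un; rewrite -(ltn_add2l #|U'|) cardsC -(cardsC U) ltn_add2r.
by rewrite -card_gt0; apply: leq_ltn_trans ltU.
Qed.

(** The values of [psi] that a correction by 0, [a] or [-a] could turn into [x]. *)
Definition near (Gamma : finZmodType) (a x : Gamma) : {set Gamma} := [set x; x + a; x - a].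

(** The corrected flow together with the set [bad psi] determines [psi]. As the complement of [S] is
    connected, [S] has at most [n.+1] edges, whence the factor [2 ^ n.+1]. *)
Lemma flows_avoiding_lower_bound (G : ograph) (Gamma : finZmodType) (f : edge G -> Gamma) 
    (a : Gamma) c q : edge_connected 3 G -> a != 0 ->
    (forall e, #|near a (f e)| <= q)%N -> (0 < c)%N -> (c + q.*2 <= #|Gamma|)%N ->
  exists2 n, #|edge G| = (#|vertex G| + n)%N & (c ^ n <= 2 ^ n.+1 * #|flows_avoiding f|)%N.
Proof.
move=> hG a0 forb_q c0 cq; pose forb e := near a (f e).
have [S [_ conS _ [m mS ltm]]] := stage_exists (forb := forb) forb_q cq hG.
have innerT : inner setT = [set: edge G] by apply/setP=> e; rewrite !inE.
rewrite innerT setTD cardsT [#|[set: vertex G]|]cardsT in mS ltm.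
have VS := card_vertex_connected conS.
(* Deleting one edge leaves [G] connected, so there are at least as many edges as vertices. *)
have [n En] : exists n, #|edge G| = (#|vertex G| + n)%N.
  have [V2 conG] := hG.
  have [e _] : exists e, e \in ~: S by apply/card_gt0P; rewrite -ltnS; apply: leq_trans VS.
  have /card_vertex_connected : forall u v, links (~: [set e]) u v.
    by move=> u v; rewrite /links setCK; apply: conG; rewrite cards1.
  rewrite cardsC1 prednK; last by apply/card_gt0P; exists e.
  by move=> VE; exists (#|edge G| - #|vertex G|)%N; rewrite subnKC.
exists n => //.
have Sn : (#|S| <= n.+1)%N.
  by rewrite -(leq_add2r #|~: S|) cardsC En addSnnS addnC leq_add2l.
have nm : (n <= m)%N by move: ltm; rewrite En addnC ltn_add2r; apply: ltnW.
pose psi0 : {ffun edge G -> Gamma} := [ffun=> 0].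
have psi0P : is_flow psi0.
  apply/is_flowP => v; rewrite /boundary big1 // => e _.
  by rewrite ffunE mul0rz.
apply: leq_trans (leq_pexp2l c0 nm) _; apply: leq_trans (mS _ psi0P) _.
(* Intersecting with [S] makes [signed_flow] applicable to every [B]; [bad psi] lies in [S]
   already. *)
have /fin_all_exists[chi chiP] (B : {set edge G}) : exists chi : edge G -> int,
  [/\ forall v, boundary chi v = 0, forall e, (absz (chi e) <= 1)%N &
    forall e, e \notin ~: S -> (chi e != 0) = (e \in B :&: S)].
  by apply: signed_flow => //; rewrite setCK subsetIr.
pose bad (psi : {ffun edge G -> Gamma}) := [set e in S | psi e == f e].
pose fix_flow (psi : {ffun edge G -> Gamma}) : {ffun edge G -> Gamma} :=
  [ffun e => psi e + a *~ chi (bad psi) e].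
pose code psi := (fix_flow psi, bad psi).
have code_inj : injective code.
  move=> psi psi' [Ef Eb]; apply/ffunP => e.
  by move/ffunP/(_ e): Ef; rewrite !ffunE Eb => /addIr.
rewrite -(card_imset _ code_inj).
apply: (@leq_trans #|setX (flows_avoiding f) (powerset S)|); last first.
  by rewrite cardsX card_powerset mulnC leq_mul2r leq_pexp2l ?orbT.
apply/subset_leq_card/subsetP => _ /imsetP[psi /avoidersP[psiP _ psiA] ->].
have [chi_flow chi1 chi_bad] := chiP (bad psi).
rewrite inE /= powersetE; apply/andP; split; last first.
  by apply/subsetP=> e; rewrite inE => /andP[].
rewrite inE; apply/andP; split.
  apply/is_flowP => v; rewrite /boundary; under eq_bigr do rewrite ffunE.
  rewrite -/(boundary (fun e => psi e + a *~ chi (bad psi) e) v).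
  by rewrite boundaryD boundaryZ chi_flow mulr0z addr0; apply/is_flowP.
apply/forallP => e; rewrite ffunE.
have chiE : [\/ chi (bad psi) e = 0, chi (bad psi) e = 1 | chi (bad psi) e = -1].
  have := chi1 e; case: (chi _ e) => [[|[|k]]|[|k]] // _.
  - by constructor 1.
  - by constructor 2.
  by constructor 3.
(* Outside [S], the values excluded by [near] keep the sum off [f e] whatever [chi] is. On [S],
   [chi] is nonzero exactly where [psi] equals [f], and [a] is not 0. *)
have [eS|eS] := boolP (e \in S); last first.
  have := psiA e; rewrite !inE eS !negb_or => /(_ isT)/andP[/andP[n1 n2] n3].
  case: chiE => ->; rewrite ?mulr0z ?addr0 ?mulr1z ?mulrN1z ?subr_eq //.
  by rewrite -[a in X in ~~ X]opprK subr_eq.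
have := chi_bad e; rewrite !inE eS /= andbT => /(_ isT).
have [->|nf] := eqVneq (psi e) (f e); last by move/negbFE/eqP->; rewrite mulr0z addr0.
case: chiE => -> // _; rewrite ?mulrN1z ?mulr1z -subr_eq0 addrAC subrr add0r ?oppr_eq0 //.
Qed.

(** * Groups of odd and even order *)

Lemma even_card_involution (Gamma : finZmodType) : ~~ odd #|Gamma| ->
  exists2 a : Gamma, a != 0 & a + a = 0.
Proof.
move=> even; have [||a _ oa] := @Cauchy Gamma 2 [set: Gamma]%G => //.
  by rewrite cardsT dvdn2.
exists a; first by rewrite -FinRing.zmod1gE -order_eq1 oa.
by rewrite -mulr2n -FinRing.zmodXgE -oa expg_order.
Qed.

Theorem theorem1p9 (G : ograph) (Gamma : finZmodType) (k : nat) (l : int)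
    (hG : edge_connected 3 G)
    (hl : l = #|edge G|%:Z - #|vertex G|%:Z)
    (hk : #|Gamma| = k) (hk6 : (6 <= k)%N)
    (f : edge G -> Gamma) :
  (odd k ->
     1 / 2 * ((k%:R - 6) / 2) ^ l <= #|flows_avoiding f|%:R :> rat) /\
  (~~ odd k ->
     1 / 2 * ((k%:R - 4) / 2) ^ l <= #|flows_avoiding f|%:R :> rat).
Proof.
(* The previous bound divided by [2 ^ n.+1], with [c = k - 2q]; the integer [l] is the natural
   number [n]. *)
have bound a c q : a != 0 -> (forall e, #|near a (f e)| <= q)%N -> (0 < c)%N ->
    (c + q.*2 = k)%N ->
  1 / 2 * (c%:R / 2) ^ l <= #|flows_avoiding f|%:R :> rat.
  move=> a0 forb_q c0 cq.
  have [|n En cn] := flows_avoiding_lower_bound hG a0 forb_q c0; first by rewrite hk cq.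
  have -> : l = n by rewrite hl En PoszD addrAC subrr add0r.
  rewrite -exprnP expr_div_n mul1r mulrC -mulrA -invfM -exprSr.
  by rewrite ler_pdivrMr ?exprn_gt0 // -!natrX -natrM ler_nat mulnC.
split=> [ok|ek].
- have [a a0] : exists a : Gamma, a != 0.
    have : (0 < #|[set~ (0%R : Gamma)]|)%N.
      by rewrite cardsC1 hk -subn1 subn_gt0; apply: leq_trans hk6.
    by case/card_gt0P=> a; rewrite !inE; exists a.
  (* Oddness excludes [k = 6], so [c = k - 6] is positive. *)
  have k7 : (6 < k)%N by rewrite ltn_neqAle hk6 andbT; apply: contraTneq ok => <-.
  rewrite -natrB //; apply: (bound a (k - 6)%N 3%N); rewrite ?subn_gt0 ?subnK // => e.
  by rewrite /near -setUA !cardsU1 cards1; do 2 case: (_ \notin _).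
have [a a0 aa] : exists2 a : Gamma, a != 0 & a + a = 0 by apply: even_card_involution; rewrite hk.
have k4 : (4 < k)%N by apply: leq_trans hk6.
rewrite -natrB ?(ltnW k4) //.
apply: (bound a (k - 4)%N 2%N); rewrite ?subn_gt0 ?subnK ?(ltnW k4) // => e.
(* Two of the three values coincide, so [q = 2] is enough. *)
rewrite /near; have -> : f e - a = f e + a by congr (_ + _); apply/eqP; rewrite eq_sym -addr_eq0 aa.
by rewrite -setUA setUid cards2; case: (_ != _).
Qed.
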